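(* There is an absolute constant $c_0>0$ such that the following holds for every $c\ge c_0$. Let $F:\mathbb{R}^d\to\mathbb{R}^{n\times d}$, $b\in\mathbb{R}^n$, $\alpha>0$, and suppose that there are constants $c_1,c_2,c_3,\gamma>0$ such that, for all $x,y\in\mathbb{R}^d$, (i) $\|F(x)\|_2\leq c_1$, (ii) there is $z_x\in\mathbb{R}^d$ such that $\|z_x\|_{\ell_1}\leq c_2\|b\|$ and $F(x)z_x=b$, (iii) $\|F(x)-F(y)\|_2 \leq c_3 \|x-y\|$, (iv) if $y$ is $\frac{4}{\alpha^2}(c_1+c_2+c_1^2c_2)^2\|b\|^2$-sparse, then $(1-\gamma)\|y\|^2 \leq \|F(x)y\|^2\leq (1+\gamma) \|y\|^2$, (v) $\gamma<1-(1+2c_1c_2)c_3\|b\|$. Let $x_\alpha$ be the fixed point satisfying $x_\alpha = \arg\min_{y\in\mathbb{R}^d} \|F(x_\alpha)y-b\|^2+\alpha\|y\|_{\ell_1}$, and let $x_\alpha$ be $k$-sparse. Define $\hat{z}_\alpha := (I-F(x_\alpha)^*F(x_\alpha))x_\alpha + F(x_\alpha)^*b$ and $$K=\frac{4\|x_\alpha\|^2}{\alpha^2} + \frac{4c}{\alpha}C,\qquad C=\sup_{1\leq l<d}\big(\sqrt{l+1}\,\|\hat{z}_\alpha-(\hat{z}_\alpha)_{\{l\}}\|\big).$$ Additionally assume that (a) there is $0<\tilde{\gamma}<\gamma$ such that, for all $(K+k)$-sparse vectors $y\in\mathbb{R}^d$, $(1-\tilde{\gamma})\|y\|^2\leq\|F(x_\alpha)y\|^2\leq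 (1+\tilde{\gamma})\|y\|^2$, (b) $\tilde{\gamma}+(1+4c_1c_2)c_3\|b\|<\gamma$. Then the iteration $x^{(0)}_\alpha=0$, $$x^{(j+1)}_\alpha:=\mathbb{S}_\alpha \big( (I- F(x^{(j)}_\alpha)^* F(x^{(j)}_\alpha)) x^{(j)}_\alpha + F(x^{(j)}_\alpha)^*b \big),\quad j=0,1,2,\ldots,$$ converges towards $x_\alpha$ with $$\|x^{(j)}_\alpha-x_\alpha\|\leq \gamma^j \|x_\alpha\|,\quad j=0,1,2,\ldots.$$
   Context: $\|\cdot\|$ is the Euclidean norm, $\|\cdot\|_2$ the spectral norm of matrices, $\|\cdot\|_{\ell_1}$ the $\ell_1$-norm, $M^*$ the transpose of $M$. For a real number $s\ge 0$, a vector is $s$-sparse if it has at most $s$ nonzero entries. $z_{\{l\}}$ is the best $l$-sparse approximation of $z$: it keeps the $l$ largest entries of $z$ in absolute value and is zero elsewhere. $\mathbb{S}_\alpha:\mathbb{R}^d\to\mathbb{R}^d$ is soft-thresholding: $(\mathbb{S}_\alpha(x))_i=x_i-\alpha/2$ if $x_i\geq\alpha/2$, $=0$ if $-\alpha/2<x_i<\alpha/2$, and $=x_i+\alpha/2$ if $x_i\leq-\alpha/2$. The map $\mathscr{S}_\alpha(x):=\arg\min_{y\in\mathbb{R}^d}\|F(x)y-b\|^2+\alpha\|y\|_{\ell_1}$ is taken to be well defined; $x_\alpha$ is the fixed point of $\mathscr{S}_\alpha$, obtained as the limit of the iteration $x\mapsto\mathscr{S}_\alpha(x)$, which converges from any initial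 vector under (i)–(v). *)

(* Defs.v *)
From HB Require Import structures.
From mathcomp Require Import all_boot all_order all_algebra.
From mathcomp Require Import all_classical all_reals all_analysis.

Set Implicit Arguments.
Unset Strict Implicit.
Unset Printing Implicit Defensive.

Import Order.TTheory GRing.Theory Num.Theory.
Import numFieldNormedType.Exports.

Local Open Scope classical_set_scope.
Local Open Scope ring_scope.

(* The library norm [`|x|] of a matrix is the sup norm, hence the definitions
   of the other norms below. *)
Definition enorm (R : realType) (m : nat) (x : 'cV[R]_m) : R :=
  Num.sqrt (\sum_(i < m) x i 0 ^+ 2).

Definition l1norm (R : realType) (m : nat) (x : 'cV[R]_m) : R :=
  \sum_(i < m) `|x i 0|.

Definition spectral_norm (R : realType) (m p : nat) (M : 'M[R]_(m, p)) : R :=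
  sup [set enorm (M *m x) | x in [set x : 'cV[R]_p | enorm x <= 1]].

(* The sparsity level is a real number, not necessarily an integer. *)
Definition sparse (R : realType) (m : nat) (s : R) (x : 'cV[R]_m) : Prop :=
  #|[pred i : 'I_m | x i 0 != 0]|%:R <= s.

(* [keeps_rank l z i]: the entry [i] is among the [l] largest entries of [z] in
   absolute value; ties are resolved in favour of the smaller index.  The
   choice does not affect the norm of [z - best_approx l z]. *)
Definition keeps_rank (R : realType) (m l : nat) (z : 'cV[R]_m) (i : 'I_m) :
    bool :=
  (#|[pred j : 'I_m | ((`|z i 0| < `|z j 0|)
        || ((`|z j 0| == `|z i 0|) && (j < i)%N))%R]| < l)%N.

Definition best_approx (R : realType) (m l : nat) (z : 'cV[R]_m) : 'cV[R]_m :=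
  \col_i (if keeps_rank l z i then z i 0 else 0).

Definition soft_threshold (R : realType) (m : nat) (alpha : R)
    (x : 'cV[R]_m) : 'cV[R]_m :=
  \col_i (if alpha / 2 <= x i 0 then x i 0 - alpha / 2
          else if x i 0 <= - (alpha / 2) then x i 0 + alpha / 2
          else 0).

Definition lasso (R : realType) (n d : nat) (M : 'M[R]_(n, d)) (b : 'cV[R]_n)
    (alpha : R) (y : 'cV[R]_d) : R :=
  enorm (M *m y - b) ^+ 2 + alpha * l1norm y.

(* [x = arg min f], the minimizer being unique. *)
Definition is_argmin (R : realType) (T : Type) (f : T -> R) (x : T) : Prop :=
  forall y : T, f x <= f y /\ (f y = f x -> y = x).

Definition rip (R : realType) (n d : nat) (s delta : R) (M : 'M[R]_(n, d)) :
    Prop :=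
  forall y : 'cV[R]_d, sparse s y ->
    (1 - delta) * enorm y ^+ 2 <= enorm (M *m y) ^+ 2 /\
    enorm (M *m y) ^+ 2 <= (1 + delta) * enorm y ^+ 2.

Definition forward_step (R : realType) (n d : nat)
    (F : 'cV[R]_d -> 'M[R]_(n, d)) (b : 'cV[R]_n) (x : 'cV[R]_d) : 'cV[R]_d :=
  (1%:M - (F x)^T *m F x) *m x + (F x)^T *m b.

Definition thresholding_step (R : realType) (n d : nat)
    (F : 'cV[R]_d -> 'M[R]_(n, d)) (b : 'cV[R]_n) (alpha : R)
    (x : 'cV[R]_d) : 'cV[R]_d :=
  soft_threshold alpha (forward_step F b x).

Definition iterate (R : realType) (n d : nat)
    (F : 'cV[R]_d -> 'M[R]_(n, d)) (b : 'cV[R]_n) (alpha : R) (j : nat) :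
    'cV[R]_d :=
  iter j (thresholding_step F b alpha) 0.

(* For [d <= 1] the supremum is over the empty set, and its value is [0]. *)
Definition tail_sup (R : realType) (d : nat) (z : 'cV[R]_d) : R :=
  sup [set Num.sqrt l.+1%:R * enorm (z - best_approx l z)
      | l in [set l : nat | (1 <= l < d)%N]].

(* Main.v *)
Require Import Defs.
From HB Require Import structures.
From mathcomp Require Import all_boot all_order all_algebra.
From mathcomp Require Import all_classical all_reals all_analysis.
From mathcomp Require Import ring lra zify.

Set Implicit Arguments.
Unset Strict Implicit.
Unset Printing Implicit Defensive.

Import Order.TTheory GRing.Theory Num.Theory.
Import numFieldNormedType.Exports.

Local Open Scope classical_set_scope.
Local Open Scope ring_scope.

(** Write [t = alpha / 2], [m = enorm xa], [e j] for the error of the [j]-th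
    iterate and [g] for the correction [F(xa)^T (b - F(xa) xa)], so that [xa + g]
    is the forward step at [xa].  Optimality of [xa] says that [`|g i|] is at
    most [t], with [g i] equal to [t] times the sign of [xa i] on the support of
    [xa]; in particular [xa] is fixed by the thresholded iteration.

    If [w] is the difference of the forward steps at the iterate and at [xa],
    then restricted isometry makes [w], restricted to the supports in play, a
    contraction of [e j] ([forward_contraction]).  There are two contraction
    constants.  The isometry at the iterate, which holds for the large sparsity
    level, gives [rho = gamma + (1 + 2 c1 c2) c3 |b| < 1].  The isometry at [xa]
    gives at most [gamma], the rate that is wanted, but only if the supports of
    two consecutive iterates and of [xa] have at most [K + k] elements together.

    The key is an energy inequality for soft thresholding ([shrink_energy]): a
    coordinate that becomes active has paid [t - `|g i|] to reach the threshold,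
    and the square of this price is lost to the error.  With [gap A] the sum of
    these squares over [A], one obtains
      [enorm (e j.+1) ^+ 2 + gap (L j.+1) <= rho ^+ 2 * enorm (e j) ^+ 2],
    where [L j] is the joint support of the [j]-th iterate and [xa].  So the
    prices of all active coordinates are bounded by [m ^+ 2].  On the one hand
    this keeps supports below the large sparsity level ([gap_room],
    [supports_small]), so that the estimate with [rho] always applies.  On the
    other hand, suppose that two consecutive supports have more than [K + k]
    elements together.  Only [k + 2 c C / t] indices have [`|g i|] at least
    [t / 64], by the definition of [C] as a supremum of tails
    ([card_large_le_tail_sup]), so more than [(m / t) ^+ 2] indices cost almost
    [t ^+ 2] each ([gap_large]): nearly all of the energy is spent, and the
    error after these two steps is much smaller than required ([energy_loss]).
    Thus the rate [gamma] holds in every step at which the supports are small,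
    and the bound [gamma ^+ j * m] survives the other steps as well. *)

(** * Euclidean geometry of column vectors *)

Definition dot (R : realType) (m : nat) (u v : 'cV[R]_m) : R :=
  \sum_(i < m) u i 0 * v i 0.

Section Euclidean.
Variable R : realType.
Implicit Types m n p : nat.

Lemma dotC m (u v : 'cV[R]_m) : dot u v = dot v u.
Proof. by apply: eq_bigr => i _; rewrite mulrC. Qed.

Lemma dotDl m (u v w : 'cV[R]_m) : dot (u + v) w = dot u w + dot v w.
Proof. by rewrite -big_split; apply: eq_bigr => i _; rewrite !mxE mulrDl. Qed.

Lemma dotDr m (u v w : 'cV[R]_m) : dot w (u + v) = dot w u + dot w v.
Proof. by rewrite dotC dotDl !(dotC w). Qed.

Lemma dotZl m (a : R) (u v : 'cV[R]_m) : dot (a *: u) v = a * dot u v.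
Proof. by rewrite /dot mulr_sumr; apply: eq_bigr => i _; rewrite !mxE mulrA. Qed.

Lemma dotZr m (a : R) (u v : 'cV[R]_m) : dot u (a *: v) = a * dot u v.
Proof. by rewrite dotC dotZl dotC. Qed.

Lemma dotNl m (u v : 'cV[R]_m) : dot (- u) v = - dot u v.
Proof. by rewrite -scaleN1r dotZl mulN1r. Qed.

Lemma dotNr m (u v : 'cV[R]_m) : dot u (- v) = - dot u v.
Proof. by rewrite dotC dotNl dotC. Qed.

Lemma dot_adjoint m n (A : 'M[R]_(m, n)) (u : 'cV[R]_n) (v : 'cV[R]_m) :
  dot u (A^T *m v) = dot (A *m u) v.
Proof.
have dotE k (x y : 'cV[R]_k) : dot x y = (x^T *m y) 0 0.
  by rewrite mxE; apply: eq_bigr => i _; rewrite mxE.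
by rewrite !dotE trmx_mul mulmxA.
Qed.

Lemma dot_ge0 m (u : 'cV[R]_m) : 0 <= dot u u.
Proof. by apply: sumr_ge0 => i _; rewrite -expr2 sqr_ge0. Qed.

Lemma dotvv m (u : 'cV[R]_m) : dot u u = enorm u ^+ 2.
Proof.
rewrite sqr_sqrtr; first by apply: eq_bigr => i _; rewrite expr2.
by apply: sumr_ge0 => i _; rewrite sqr_ge0.
Qed.

Lemma enorm_ge0 m (u : 'cV[R]_m) : 0 <= enorm u.
Proof. exact: sqrtr_ge0. Qed.

Lemma sqr_enorm m (u : 'cV[R]_m) : enorm u ^+ 2 = \sum_i u i 0 ^+ 2.
Proof. by rewrite -dotvv; apply: eq_bigr => i _; rewrite expr2. Qed.

Lemma enormZ m (a : R) (u : 'cV[R]_m) : enorm (a *: u) = `|a| * enorm u.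
Proof.
apply/eqP; rewrite -(@eqrXn2 _ 2) ?mulr_ge0 ?enorm_ge0 ?normr_ge0//.
by rewrite exprMn real_normK ?num_real// -!dotvv dotZl dotZr mulrA expr2.
Qed.

Lemma enormN m (u : 'cV[R]_m) : enorm (- u) = enorm u.
Proof. by rewrite -scaleN1r enormZ normrN1 mul1r. Qed.

Lemma enorm0 m : enorm (0 : 'cV[R]_m) = 0.
Proof. by rewrite -(scale0r (0 : 'cV[R]_m)) enormZ normr0 mul0r. Qed.

Lemma entry_le_enorm m (u : 'cV[R]_m) i : `|u i 0| <= enorm u.
Proof.
rewrite -(@ler_pXn2r _ 2) ?nnegrE ?enorm_ge0// real_normK ?num_real//.
rewrite sqr_enorm (bigD1 i)//= lerDl.
by apply: sumr_ge0 => j _; rewrite sqr_ge0.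
Qed.

Lemma enorm_eq0 m (u : 'cV[R]_m) : enorm u = 0 -> u = 0.
Proof.
move=> u0; apply/colP => i; rewrite mxE; apply/eqP.
by rewrite -normr_le0 -u0 entry_le_enorm.
Qed.

Lemma enorm_gt0 m (u : 'cV[R]_m) : u != 0 -> 0 < enorm u.
Proof.
by move=> u0; rewrite lt_neqAle enorm_ge0 andbT; apply: contraNN u0 => /eqP u0;
  apply/eqP/enorm_eq0.
Qed.

Lemma cauchy_schwarz m (u v : 'cV[R]_m) : dot u v <= enorm u * enorm v.
Proof.
have [->|u0] := eqVneq u 0.
  by rewrite enorm0 mul0r /dot big1// => i _; rewrite mxE mul0r.
have [->|v0] := eqVneq v 0.
  by rewrite enorm0 mulr0 /dot big1// => i _; rewrite mxE mulr0.
have nu := enorm_gt0 u0; have nv := enorm_gt0 v0.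
have := dot_ge0 (enorm v *: u - enorm u *: v).
rewrite dotDl !dotDr !dotNl !dotNr !dotZl !dotZr (dotC v u) !dotvv => H.
have {}H : 0 <= 2 * (enorm u * enorm v) * (enorm u * enorm v - dot u v) by lra.
by rewrite -subr_ge0 -(pmulr_rge0 _ (_ : 0 < 2 * (enorm u * enorm v)))// !mulr_gt0.
Qed.

Lemma ler_enormD m (u v : 'cV[R]_m) : enorm (u + v) <= enorm u + enorm v.
Proof.
rewrite -(@ler_pXn2r _ 2) ?nnegrE ?addr_ge0 ?enorm_ge0//.
rewrite -dotvv dotDl !dotDr (dotC v u) !dotvv.
by have := cauchy_schwarz u v; lra.
Qed.

Lemma enorm_le_l1norm m (u : 'cV[R]_m) : enorm u <= l1norm u.
Proof.
have l1_ge0 : 0 <= l1norm u by apply: sumr_ge0 => i _.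
rewrite -(@ler_pXn2r _ 2) ?nnegrE ?enorm_ge0// sqr_enorm expr2.
rewrite [X in _ <= X]mulr_suml; apply: ler_sum => i _.
rewrite -(@real_normK _ (u i 0)) ?num_real// expr2 ler_wpM2l//.
by rewrite /l1norm (bigD1 i)//= lerDl sumr_ge0.
Qed.

(** Finiteness of the supremum that defines the spectral norm: the Frobenius
    norm of the matrix bounds it. *)
Lemma enorm_mulmx_bounded n p (M : 'M[R]_(n, p)) :
  exists2 B : R, 0 <= B & forall x, enorm (M *m x) <= B * enorm x.
Proof.
pose row_vec i : 'cV[R]_p := (row i M)^T.
have MxE x i : (M *m x) i 0 = dot (row_vec i) x.
  by rewrite mxE; apply: eq_bigr => j _; rewrite !mxE.
pose B2 := \sum_i enorm (row_vec i) ^+ 2.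
have B2_ge0 : 0 <= B2 by apply: sumr_ge0 => i _; rewrite sqr_ge0.
exists (Num.sqrt B2); first exact: sqrtr_ge0.
move=> x; rewrite -(@ler_pXn2r _ 2) ?nnegrE ?mulr_ge0 ?enorm_ge0 ?sqrtr_ge0//.
rewrite exprMn (sqr_sqrtr B2_ge0) (sqr_enorm (M *m x)) mulr_suml; apply: ler_sum => i _.
rewrite MxE -real_normK ?num_real// -exprMn ler_pXn2r ?nnegrE ?mulr_ge0 ?enorm_ge0//.
rewrite ler_norml cauchy_schwarz andbT lerNl.
by rewrite -dotNl -(enormN (row_vec i)) cauchy_schwarz.
Qed.

Lemma enorm_mulmx_le n p (M : 'M[R]_(n, p)) x :
  enorm (M *m x) <= spectral_norm M * enorm x.
Proof.
have [->|x0] := eqVneq x 0; first by rewrite mulmx0 !enorm0 mulr0.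
have nx := enorm_gt0 x0.
rewrite -ler_pdivrMr// mulrC -[X in X * _]gtr0_norm ?invr_gt0// -enormZ scalemxAr.
apply: ub_le_sup; last first.
  exists ((enorm x)^-1 *: x) => //=.
  by rewrite enormZ gtr0_norm ?invr_gt0// mulVf// gt_eqF.
have [B B0 HB] := enorm_mulmx_bounded M.
exists B => _ [y /= y1 <-]; apply: (le_trans (HB y)).
by rewrite -[leRHS]mulr1 ler_wpM2l.
Qed.

Lemma enorm_mulmx_bound n p (M : 'M[R]_(n, p)) (a : R) x :
  spectral_norm M <= a -> enorm (M *m x) <= a * enorm x.
Proof.
by move=> Ma; rewrite (le_trans (enorm_mulmx_le M x))// ler_wpM2r ?enorm_ge0.
Qed.

Lemma enorm_trmx_bound n p (M : 'M[R]_(n, p)) (a : R) y :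
  0 <= a -> spectral_norm M <= a -> enorm (M^T *m y) <= a * enorm y.
Proof.
move=> a0 Ma; set v := M^T *m y; have [->|v0] := eqVneq v 0.
  by rewrite enorm0 mulr_ge0 ?enorm_ge0.
rewrite -(ler_pM2l (enorm_gt0 v0)) -expr2 -dotvv {2}/v dot_adjoint.
apply: (le_trans (cauchy_schwarz _ _)).
by rewrite mulrCA mulrA ler_wpM2r ?enorm_ge0// enorm_mulmx_bound.
Qed.

End Euclidean.

(** * Restriction to a set of indices and restricted isometry *)

Definition restr (R : realType) (m : nat) (L : {set 'I_m}) (x : 'cV[R]_m) :
    'cV[R]_m :=
  \col_i (if i \in L then x i 0 else 0).

Definition supported (R : realType) (m : nat) (L : {set 'I_m}) (x : 'cV[R]_m) :
    Prop :=
  forall i, i \notin L -> x i 0 = 0.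

Section Restriction.
Variable R : realType.
Implicit Types m n d : nat.

Lemma restr_supported m (L : {set 'I_m}) (x : 'cV[R]_m) :
  supported L (restr L x).
Proof. by move=> i /negbTE iL; rewrite mxE iL. Qed.

Lemma restrD m (L : {set 'I_m}) (x y : 'cV[R]_m) :
  restr L (x + y) = restr L x + restr L y.
Proof. by apply/colP => i; rewrite !mxE; case: ifP => //; rewrite addr0. Qed.

Lemma restrN m (L : {set 'I_m}) (x : 'cV[R]_m) : restr L (- x) = - restr L x.
Proof. by apply/colP => i; rewrite !mxE; case: ifP => //; rewrite oppr0. Qed.

Lemma sqr_enorm_restr m (L : {set 'I_m}) (x : 'cV[R]_m) :
  enorm (restr L x) ^+ 2 = \sum_(i in L) x i 0 ^+ 2.
Proof.
rewrite sqr_enorm [RHS]big_mkcond; apply: eq_bigr => i _.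
by rewrite mxE; case: ifP => //; rewrite expr0n.
Qed.

Lemma enorm_restr_mono m (A B : {set 'I_m}) (x : 'cV[R]_m) :
  A \subset B -> enorm (restr A x) <= enorm (restr B x).
Proof.
move=> /fintype.subsetP AB; rewrite -(@ler_pXn2r _ 2) ?nnegrE ?enorm_ge0//.
rewrite !sqr_enorm_restr !(big_mkcond (fun i => i \in _)).
apply: ler_sum => i _; case: ifPn => [/AB ->//|_].
by case: ifP; rewrite // sqr_ge0.
Qed.

Lemma enorm_restr_le m (L : {set 'I_m}) (x : 'cV[R]_m) :
  enorm (restr L x) <= enorm x.
Proof.
rewrite -(@ler_pXn2r _ 2) ?nnegrE ?enorm_ge0// sqr_enorm_restr sqr_enorm.
rewrite big_mkcond; apply: ler_sum => i _.
by case: ifP => // _; rewrite sqr_ge0.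
Qed.

Lemma dot_restr m (L : {set 'I_m}) (x : 'cV[R]_m) :
  dot (restr L x) x = enorm (restr L x) ^+ 2.
Proof.
rewrite sqr_enorm_restr [RHS]big_mkcond; apply: eq_bigr => i _.
by rewrite mxE; case: ifP; rewrite ?mul0r// expr2.
Qed.

Lemma supported_sparse m (L : {set 'I_m}) (s : R) (x : 'cV[R]_m) :
  #|L|%:R <= s -> supported L x -> sparse s x.
Proof.
move=> Ls xL; apply: le_trans Ls; rewrite ler_nat.
apply/subset_leq_card/fintype.subsetP => i; rewrite inE => xi.
by apply: contraNT xi => /xL ->.
Qed.

Lemma supportedD m (L : {set 'I_m}) (x y : 'cV[R]_m) :
  supported L x -> supported L y -> supported L (x + y).
Proof. by move=> xL yL i iL; rewrite mxE xL// yL// addr0. Qed.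

Lemma supportedZ m (L : {set 'I_m}) (a : R) (x : 'cV[R]_m) :
  supported L x -> supported L (a *: x).
Proof. by move=> xL i iL; rewrite mxE xL// mulr0. Qed.

Lemma supportedB m (L : {set 'I_m}) (x y : 'cV[R]_m) :
  supported L x -> supported L y -> supported L (x - y).
Proof. by move=> xL yL i iL; rewrite !mxE xL// yL// subr0. Qed.

(** Restricted isometry says that the quadratic form of [1 - M^T M] is bounded
    by [delta] on vectors supported in [L]; since this form is symmetric,
    polarization turns this into an operator bound. *)
Lemma rip_gram n d (M : 'M[R]_(n, d)) (s delta : R) (L : {set 'I_d}) y :
  0 < delta -> rip s delta M -> #|L|%:R <= s -> supported L y ->
  enorm (restr L (y - M^T *m (M *m y))) <= delta * enorm y.
Proof.
move=> delta0 ripM Ls yL.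
set v := y - _; set u := restr L v.
have uL : supported L u by exact: restr_supported.
have form_bound z : supported L z ->
    `|dot z (z - M^T *m (M *m z))| <= delta * enorm z ^+ 2.
  move=> zL; have [lo hi] := ripM z (supported_sparse Ls zL).
  rewrite dotDr dotNr dot_adjoint !dotvv ler_norml; apply/andP; split; lra.
(* the scaling of [u] by [delta^-1] balances the two squares on the right *)
pose u' := delta^-1 *: u.
have := form_bound (u' + y) (supportedD (supportedZ _ uL) yL).
have := form_bound (u' - y) (supportedB (supportedZ _ uL) yL).
rewrite !mulmxDr !mulmxN !dotDl !dotDr !dotNl !dotNr !opprK.
rewrite !dotDr !dotNr -!dotvv !dotDl !dotDr !dotNl !dotNr.
rewrite !dot_adjoint.
have uv : dot u' y - dot (M *m u') (M *m y) = delta^-1 * enorm u ^+ 2.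
  by rewrite -dot_restr -/u -dotZl -/u' /v dotDr dotNr dot_adjoint.
rewrite (dotC y u') (dotC (M *m y) (M *m u')).
rewrite !ler_norml => /andP[B1 _] /andP[_ B2].
have uu : dot u' u' = delta^-1 ^+ 2 * enorm u ^+ 2.
  by rewrite dotZl dotZr dotvv mulrA -expr2.
have H : 4 * (delta^-1 * enorm u ^+ 2) <=
    2 * delta * (delta^-1 ^+ 2 * enorm u ^+ 2) + 2 * delta * enorm y ^+ 2.
  rewrite -uv -uu -(dotvv y).
  move: B1 B2; move: (dot u' u') (dot u' y) (dot y y) (dot (M *m u') (M *m u'))
    (dot (M *m u') (M *m y)) (dot (M *m y) (M *m y)) => *; lra.
have dV : delta * delta^-1 = 1 by rewrite divff ?gt_eqF.
have {}H : delta^-1 * enorm u ^+ 2 <= delta * enorm y ^+ 2.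
  have -> : delta^-1 * enorm u ^+ 2 =
      delta * (delta^-1 ^+ 2 * enorm u ^+ 2).
    by rewrite expr2 !mulrA dV mul1r.
  move: H; have -> : delta^-1 * enorm u ^+ 2 =
      delta * (delta^-1 ^+ 2 * enorm u ^+ 2).
    by rewrite expr2 !mulrA dV mul1r.
  lra.
rewrite -(@ler_pXn2r _ 2) ?nnegrE ?mulr_ge0 ?enorm_ge0 ?(ltW delta0)//.
rewrite exprMn (expr2 delta) -mulrA -[leLHS]mul1r -dV -mulrA.
by rewrite ler_pM2l.
Qed.

Lemma gram_lipschitz n d (A B : 'M[R]_(n, d)) (a r : R) y :
  0 <= a -> 0 <= r -> spectral_norm A <= a -> spectral_norm B <= a ->
  spectral_norm (A - B) <= r ->
  enorm (A^T *m (A *m y) - B^T *m (B *m y)) <= 2 * a * r * enorm y.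
Proof.
move=> a0 r0 Aa Ba ABr.
have -> : A^T *m (A *m y) - B^T *m (B *m y) =
    A^T *m ((A - B) *m y) + (A - B)^T *m (B *m y).
  by rewrite mulmxBl mulmxBr linearB/= mulmxBl addrA subrK.
apply: (le_trans (ler_enormD _ _)).
have H1 : enorm (A^T *m ((A - B) *m y)) <= a * (r * enorm y).
  apply: (le_trans (enorm_trmx_bound _ a0 Aa)).
  by rewrite ler_wpM2l// enorm_mulmx_bound.
have H2 : enorm ((A - B)^T *m (B *m y)) <= r * (a * enorm y).
  apply: (le_trans (enorm_trmx_bound _ r0 ABr)).
  by rewrite ler_wpM2l// enorm_mulmx_bound.
lra.
Qed.

Lemma forward_stepE n d (F : 'cV[R]_d -> 'M[R]_(n, d)) b x :
  forward_step F b x = x + (F x)^T *m (b - F x *m x).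
Proof.
by rewrite /forward_step mulmxBl mul1mx mulmxBr -mulmxA addrAC addrA.
Qed.

(** The point [x] at which isometry is assumed and the point [z] whose norm is
    controlled play different roles; both assignments of the iterate and the
    fixed point to these roles are useful, because one has a good isometry
    constant and the other has a good norm. *)
Lemma forward_contraction n d (F : 'cV[R]_d -> 'M[R]_(n, d)) b
    (c1 c3 s delta r : R) (L : {set 'I_d}) x z :
  0 <= c1 -> 0 <= c3 -> 0 < delta ->
  (forall y, spectral_norm (F y) <= c1) ->
  (forall y y', spectral_norm (F y - F y') <= c3 * enorm (y - y')) ->
  rip s delta (F x) -> #|L|%:R <= s -> supported L x -> supported L z ->
  enorm z <= r ->
  enorm (restr L (forward_step F b x - forward_step F b z)) <=
    (delta + 2 * c1 * c3 * r + c3 * enorm b) * enorm (x - z).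
Proof.
move=> c1_0 c3_0 delta0 Fbd Flip ripF Ls xL zL zr; set e := x - z.
set A := F x; set B := F z.
have -> : forward_step F b x - forward_step F b z =
    (e - A^T *m (A *m e)) +
    ((B^T *m (B *m z) - A^T *m (A *m z)) + (A - B)^T *m b).
  have -> : (A - B)^T = A^T - B^T by rewrite linearB.
  rewrite !forward_stepE -/A -/B /e !mulmxBl !mulmxBr.
  apply/colP => i; rewrite !mxE; ring.
rewrite restrD; apply: (le_trans (ler_enormD _ _)).
have e0 : 0 <= c3 * enorm e by rewrite mulr_ge0 ?enorm_ge0.
have H1 := rip_gram delta0 ripF Ls (supportedB xL zL).
have H2 : enorm (B^T *m (B *m z) - A^T *m (A *m z)) <=
    2 * c1 * (c3 * enorm e) * r.
  rewrite -enormN opprB.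
  apply: (le_trans (gram_lipschitz z c1_0 e0 (Fbd x) (Fbd z) (Flip x z))).
  by rewrite ler_wpM2l// !mulr_ge0 ?enorm_ge0.
have H3 : enorm ((A - B)^T *m b) <= c3 * enorm e * enorm b.
  exact: (enorm_trmx_bound b e0 (Flip x z)).
have H4 := enorm_restr_le L
  ((B^T *m (B *m z) - A^T *m (A *m z)) + (A - B)^T *m b).
have H5 := ler_enormD (B^T *m (B *m z) - A^T *m (A *m z)) ((A - B)^T *m b).
have -> : (delta + 2 * c1 * c3 * r + c3 * enorm b) * enorm e =
  delta * enorm e + (2 * c1 * (c3 * enorm e) * r + c3 * enorm e * enorm b).
  by ring.
by apply: lerD => //; apply: (le_trans H4); apply: (le_trans H5); apply: lerD.
Qed.

End Restriction.

(** * Soft thresholding and the optimality condition *)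

Definition shrink (R : realType) (t x : R) : R :=
  if t <= x then x - t else if x <= - t then x + t else 0.

(** [subgradient t x g]: the number [g] belongs to [t] times the
    subdifferential of the absolute value at [x]. *)
Definition subgradient (R : realType) (t x g : R) : Prop :=
  [/\ `|g| <= t, 0 < x -> g = t & x < 0 -> g = - t].

Section Thresholding.
Variable R : realType.

Lemma soft_thresholdE m (alpha : R) (x : 'cV[R]_m) i :
  soft_threshold alpha x i 0 = shrink (alpha / 2) (x i 0).
Proof. by rewrite mxE. Qed.

(** Here [x + g] is shrunk to [x].  A perturbation [w] that makes a vanishing
    coordinate survive must first cover the distance [t - `|g|] to the
    threshold, and only what is left of it shows up in the error. *)
Lemma shrink_energy (t x g w : R) :
  subgradient t x g -> (x != 0) || (shrink t (x + g + w) != 0) ->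
  (shrink t (x + g + w) - x) ^+ 2 + (t - `|g|) ^+ 2 <= w ^+ 2.
Proof.
case=> gt gpos gneg.
have t0 : 0 <= t by apply: le_trans gt; exact: normr_ge0.
have sqrD (a b : R) : 0 <= a * b -> a ^+ 2 + b ^+ 2 <= (a + b) ^+ 2 by lra.
have far (a : R) : t <= a -> (a - 2 * t) ^+ 2 <= a ^+ 2.
  by move=> ta; have := mulr_ge0 t0 (_ : 0 <= a - t); rewrite subr_ge0 => /(_ ta); lra.
have le_sqr (a b : R) : 0 <= a <= b -> a ^+ 2 <= b ^+ 2.
  by move=> /andP[a0 ab]; rewrite ler_pXn2r ?nnegrE// (le_trans a0).
have [x0|x0|x0] := ltgtP x 0.
- rewrite (gneg x0) normrN (ger0_norm t0) subrr expr0n addr0 /shrink => _.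
  case: (leP t _) => [tv|vt].
    have -> : x - t + w - t - x = w - 2 * t by ring.
    by apply: far; lra.
  case: (leP _ (- t)) => [tv|tv]; first by lra.
  by rewrite sub0r; apply: le_sqr; lra.
- rewrite (gpos x0) (ger0_norm t0) subrr expr0n addr0 /shrink => _.
  case: (leP t _) => [tv|vt]; first by lra.
  rewrite -(sqrrN w); case: (leP _ (- t)) => [tv|tv].
    have -> : x + t + w + t - x = - (- w - 2 * t) by ring.
    by rewrite (sqrrN (- w - 2 * t)); apply: far; lra.
  by rewrite sub0r (sqrrN x); apply: le_sqr; lra.
- have [g1 g2] : g <= `|g| /\ - g <= `|g| by rewrite ler_norm -normrN ler_norm.
  rewrite x0 /= add0r subr0 /shrink; case: (leP t _) => [tv _|vt].
    apply: (le_trans (sqrD _ _ _)); first by rewrite mulr_ge0; lra.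
    by apply: le_sqr; lra.
  case: (leP _ (- t)) => [tv _|_]; last by rewrite eqxx.
  rewrite -(sqrrN w) -[in X in X + _]sqrrN.
  apply: (le_trans (sqrD _ _ _)); first by rewrite mulr_ge0; lra.
  by apply: le_sqr; lra.
Qed.

Lemma shrink_subgradient (t x g : R) : subgradient t x g -> shrink t (x + g) = x.
Proof.
move=> xg; have := @shrink_energy t x g 0 xg; rewrite addr0.
have [//|ne] := eqVneq (shrink t (x + g)) x.
have -> : (x != 0) || (shrink t (x + g) != 0).
  by apply: contra_neqT ne; rewrite negb_or !negbK => /andP[/eqP -> /eqP ->].
move=> /(_ isT) H; exfalso; move: ne; rewrite -subr_eq0 -sqrf_eq0 => /negP; apply.
by rewrite eq_le sqr_ge0 andbT; have := sqr_ge0 (t - `|g|); lra.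
Qed.

(** A step [h] of order [u / A] refutes [u > 0]. *)
Lemma first_order (A u x : R) : 0 <= A -> 0 < x ->
  (forall h, 0 < h <= x -> 2 * u * h <= A * h ^+ 2) -> u <= 0.
Proof.
move=> A0 x0 H; rewrite leNgt; apply/negP => u0.
have A1 : 0 < A + 1 by lra.
pose h := Num.min x (u / (A + 1)).
have h0 : 0 < h by rewrite lt_min x0 divr_gt0.
have hu : h * (A + 1) <= u by rewrite -ler_pdivlMr// ge_min lexx orbT.
have := H h; rewrite h0 ge_min lexx => /(_ isT); nra.
Qed.

Lemma quadratic_subgradient (A t x g : R) : 0 <= A -> 0 <= t ->
  (forall h, 0 <= A * h ^+ 2 - 2 * h * g + 2 * t * (`|x + h| - `|x|)) ->
  subgradient t x g.
Proof.
move=> A0 t0 H.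
have pos : 0 < x -> g = t.
  move=> x0; apply/eqP; rewrite eq_le; apply/andP; split; rewrite -subr_le0.
    apply: (first_order A0 x0) => h /andP[h0 hx]; have := H h.
    by rewrite !ger0_norm; lra.
  apply: (first_order A0 x0) => h /andP[h0 hx]; have := H (- h).
  by rewrite sqrrN !ger0_norm; lra.
have neg : x < 0 -> g = - t.
  rewrite -oppr_gt0 => x0; apply/eqP; rewrite eq_le; apply/andP; split; rewrite -subr_le0.
    apply: (first_order A0 x0) => h /andP[h0 hx]; have := H h.
    by rewrite !ler0_norm; lra.
  apply: (first_order A0 x0) => h /andP[h0 hx]; have := H (- h).
  by rewrite sqrrN !ler0_norm; lra.
split=> //; have [x0|x0|x0] := ltgtP x 0.
- by rewrite (neg x0) normrN ger0_norm.
- by rewrite (pos x0) ger0_norm.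
rewrite ler_norml lerNl -(subr_le0 t g) -(subr_le0 t (- g)).
by apply/andP; split; apply: (first_order A0 ltr01) => h /andP[h0 _];
  [have := H (- h)|have := H h]; rewrite ?sqrrN x0 add0r normr0 ?normrN ger0_norm; lra.
Qed.

(** Along a coordinate direction the functional is a parabola plus a multiple
    of the absolute value. *)
Lemma lasso_argmin_subgradient n d (M : 'M[R]_(n, d)) (b : 'cV[R]_n)
    (alpha : R) (x : 'cV[R]_d) :
  0 <= alpha -> is_argmin (lasso M b alpha) x ->
  forall i, subgradient (alpha / 2) (x i 0) ((M^T *m (b - M *m x)) i 0).
Proof.
move=> alpha0 xmin i; set g := M^T *m _.
pose u : 'cV[R]_d := delta_mx i 0.
have dot_u (v : 'cV[R]_d) : dot u v = v i 0.
  rewrite /dot (bigD1 i)//= big1 => [|j /negbTE ji].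
    by rewrite !mxE !eqxx mul1r addr0.
  by rewrite !mxE ji mul0r.
apply: (@quadratic_subgradient (enorm (M *m u) ^+ 2)); rewrite ?sqr_ge0 ?divr_ge0//.
move=> h; have [+ _] := xmin (x + h *: u); rewrite /lasso -subr_ge0.
have -> : M *m (x + h *: u) - b = h *: (M *m u) - (b - M *m x).
  by rewrite mulmxDr -scalemxAr opprB addrAC addrC.
have -> : enorm (M *m x - b) = enorm (b - M *m x) by rewrite -enormN opprB.
rewrite {}/g; move: (b - _) => r.
rewrite -!dotvv dotDl !dotDr !dotNl !dotNr !dotZl !dotZr.
rewrite (dotC r (M *m u)) -(dot_adjoint _ _ r) dot_u.
have -> : l1norm (x + h *: u) = l1norm x + (`|x i 0 + h| - `|x i 0|).
  rewrite /l1norm (bigD1 i)//= [in RHS](bigD1 i)//= !mxE !eqxx mulr1.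
  rewrite (eq_bigr (fun j => `|x j 0|)) => [|j /negbTE ji].
    by ring.
  by rewrite !mxE ji mulr0 addr0.
by move=> H; apply: (le_trans H); lra.
Qed.

End Thresholding.

(** * Counting large entries by the best approximation error *)

Section TailCount.
Variable R : realType.

(** The ranks of the entries are pairwise different, because the comparison
    that defines them is a strict total order. *)
Lemma card_keeps_rank d (l : nat) (z : 'cV[R]_d) :
  (#|[set i | keeps_rank l z i]%SET| <= l)%N.
Proof.
pose before := [rel i j : 'I_d | (`|z i 0| < `|z j 0|) ||
                 ((`|z j 0| == `|z i 0|) && (j < i)%N)].
pose rank i := #|[pred j | before i j]|.
have before_trans : transitive before.
  move=> j i k /orP[ij|/andP[/eqP ij ji]] /orP[jk|/andP[/eqP jk kj]] /=.
  - by rewrite (lt_trans ij jk).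
  - by rewrite jk ij.
  - by rewrite -ij jk.
  - by rewrite jk ij eqxx (ltn_trans kj ji) orbT.
have rank_lt i j : before i j -> (rank j < rank i)%N.
  move=> ij; apply/proper_card/properP; split.
    by apply/fintype.subsetP => k; rewrite !inE; exact: before_trans.
  by exists j; rewrite !inE //= ltxx ltnn andbF.
have rank_inj : injective rank.
  move=> i j rij; apply/eqP; apply: contraTT isT => ij.
  have [] : before i j \/ before j i.
    rewrite /=; have [H|H|H] := ltgtP `|z i 0| `|z j 0|; [by left|by right|].
    by move: ij; rewrite neq_ltn => /orP[H'|H']; [right|left]; rewrite H'.
  - by move/rank_lt; rewrite rij ltnn.
  - by move/rank_lt; rewrite rij ltnn.
rewrite cardE -(size_map rank) -[leqRHS](size_iota 0).
apply: uniq_leq_size; first by rewrite map_inj_uniq ?enum_uniq.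
by move=> _ /mapP[i + ->]; rewrite mem_enum inE mem_iota.
Qed.

Lemma tail_le_tail_sup d (z : 'cV[R]_d) l : (0 < l < d)%N ->
  Num.sqrt l.+1%:R * enorm (z - best_approx l z) <= tail_sup z.
Proof.
move=> /[dup] ld /andP[_ l_d].
pose f l := Num.sqrt l.+1%:R * enorm (z - best_approx l z).
have f0 j : 0 <= f j by rewrite mulr_ge0 ?sqrtr_ge0 ?enorm_ge0.
apply: ub_le_sup; last by exists l.
exists (\sum_(k < d) f k) => _ [k /= /andP[_ kd] <-].
by rewrite -/(f k) (bigD1 (Ordinal kd))//= lerDl sumr_ge0.
Qed.

Lemma tail_sup_ge0 d (z : 'cV[R]_d) : 0 <= tail_sup z.
Proof.
have [d1|d1] := ltnP 1 d.
  by apply: le_trans (tail_le_tail_sup z (l := 1) d1); rewrite mulr_ge0 ?sqrtr_ge0 ?enorm_ge0.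
rewrite /tail_sup [X in sup X](_ : _ = set0) ?sup0//.
rewrite -subset0 => _ [l /= /andP[l0 ld] _].
by have := leq_trans (leq_ltn_trans l0 ld) d1.
Qed.

(** With [l] half the number of large entries, at least half of the large
    entries survive in the [l]-th tail. *)
Lemma card_large_le_tail_sup d (z : 'cV[R]_d) (tau : R) (P : {set 'I_d}) :
  0 <= tau -> (forall i, i \in P -> tau <= `|z i 0|) -> (1 < #|P|)%N ->
  #|P|%:R * tau <= 2 * tail_sup z.
Proof.
move=> tau0 zP P1; set p := #|P|; pose l := p./2.
have p_l : p = (odd p + l + l)%N by rewrite -addnA addnn odd_double_half.
have Pd : (p <= d)%N by rewrite -[leqRHS]card_ord max_card.
have odd_b_le1 : (odd p <= 1)%N by case: odd.
have ld : (0 < l < d)%N.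
  have l0 : (0 < l)%N by rewrite half_gt0.
  by rewrite l0 (leq_trans _ Pd)// ltn_half_double -addnn; lia.
have := tail_le_tail_sup z ld; set a := enorm _ => H.
have a_ge : (p - l)%:R * tau ^+ 2 <= a ^+ 2.
  pose Q := P :\: [set i | keeps_rank l z i]%SET.
  have Ql : (p - l <= #|Q|)%N.
    rewrite cardsD leq_sub2l// (leq_trans _ (card_keeps_rank l z))//.
    exact/subset_leq_card/finset.subsetIr.
  apply: (@le_trans _ _ (#|Q|%:R * tau ^+ 2)).
    by rewrite ler_wpM2r ?sqr_ge0// ler_nat.
  rewrite /a sqr_enorm mulr_natl -sumr_const [leLHS]big_mkcond.
  apply: ler_sum => i _; case: ifPn => [|_]; last exact: sqr_ge0.
  rewrite !inE !mxE => /andP[/negbTE -> /zP zi].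
  by rewrite subr0 -(@real_normK _ (z i 0)) ?num_real// ler_pXn2r ?nnegrE.
have sl : 0 <= Num.sqrt l.+1%:R :> R := sqrtr_ge0 _.
have sl2 : Num.sqrt l.+1%:R ^+ 2 = l.+1%:R :> R by rewrite sqr_sqrtr.
have a0 : 0 <= a by exact: enorm_ge0.
rewrite -(@ler_pXn2r _ 2) ?nnegrE ?mulr_ge0 ?tail_sup_ge0//.
apply: (@le_trans _ _ ((2 * (Num.sqrt l.+1%:R * a)) ^+ 2)); last first.
  by rewrite ler_pXn2r ?nnegrE ?mulr_ge0 ?tail_sup_ge0// ler_wpM2l.
rewrite !exprMn sl2.
apply: (@le_trans _ _ (2 ^+ 2 * (l.+1%:R * ((p - l)%:R * tau ^+ 2)))); last first.
  by rewrite !ler_wpM2l.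
move: (tau ^+ 2) (sqr_ge0 tau) => tau2 tau2_ge0.
rewrite !mulrA ler_wpM2r// -!natrX -!natrM ler_nat.
clear -p_l odd_b_le1; nia.
Qed.
End TailCount.

(** * The iteration near its fixed point *)

Definition supp (R : realType) (m : nat) (x : 'cV[R]_m) : {set 'I_m} :=
  [set i | x i 0 != 0]%SET.

Section Iteration.
Variables (R : realType) (d n : nat) (F : 'cV[R]_d -> 'M[R]_(n, d)).
Variables (b : 'cV[R]_n) (alpha c1 c2 c3 gamma : R) (xa : 'cV[R]_d).

Let t := alpha / 2.
Let beta := enorm b.
Let m := enorm xa.
Let g := (F xa)^T *m (b - F xa *m xa).
Let x j := iterate F b alpha j.
Let e j := x j - xa.
Let L j := supp (x j) :|: supp xa.

(** The price, in squared error, that the indices of [A] pay to be active. *)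
Let gap (A : {set 'I_d}) := \sum_(i in A) (t - `|g i 0|) ^+ 2.

Let s0 := 4 / alpha ^+ 2 * (c1 + c2 + c1 ^+ 2 * c2) ^+ 2 * beta ^+ 2.
Let rho := gamma + (1 + 2 * c1 * c2) * c3 * beta.

Hypothesis alpha_gt0 : 0 < alpha.
Hypothesis c1_gt0 : 0 < c1.
Hypothesis c2_gt0 : 0 < c2.
Hypothesis c3_gt0 : 0 < c3.
Hypothesis gamma_gt0 : 0 < gamma.
Hypothesis F_bounded : forall y, spectral_norm (F y) <= c1.
Hypothesis F_onto : forall y,
  exists2 z : 'cV[R]_d, l1norm z <= c2 * beta & F y *m z = b.
Hypothesis F_lipschitz : forall y z,
  spectral_norm (F y - F z) <= c3 * enorm (y - z).
Hypothesis F_rip : forall y, rip s0 gamma (F y).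
Hypothesis rho_lt1 : rho < 1.
Hypothesis xa_argmin : is_argmin (lasso (F xa) b alpha) xa.

Let t_gt0 : 0 < t. Proof. by rewrite divr_gt0. Qed.

Let beta_ge0 : 0 <= beta. Proof. exact: enorm_ge0. Qed.

Let m_ge0 : 0 <= m. Proof. exact: enorm_ge0. Qed.

Lemma fixed_point_subgradient i : subgradient t (xa i 0) (g i 0).
Proof. exact: (lasso_argmin_subgradient (ltW alpha_gt0) xa_argmin). Qed.

Lemma forward_fixed : forward_step F b xa = xa + g.
Proof. exact: forward_stepE. Qed.

Lemma thresholding_fixed : thresholding_step F b alpha xa = xa.
Proof.
apply/colP => i; rewrite soft_thresholdE forward_fixed mxE.
exact: shrink_subgradient (fixed_point_subgradient i).
Qed.

Lemma iterate_fixed0 j : xa = 0 -> x j = 0.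
Proof.
by move=> xa0; rewrite /x /iterate; elim: j => //= j ->;
  rewrite -{2}xa0 -thresholding_fixed xa0.
Qed.

Lemma fixed_point_le : m <= c2 * beta.
Proof.
have [z zc Fz] := F_onto xa; apply: (le_trans (enorm_le_l1norm _)).
apply: le_trans zc; rewrite -(ler_pM2l alpha_gt0).
have [+ _] := xa_argmin z; rewrite /lasso Fz subrr enorm0.
by have := sqr_ge0 (enorm (F xa *m xa - b)); lra.
Qed.

Lemma residual_le : enorm (b - F xa *m xa) <= beta.
Proof.
rewrite -(@ler_pXn2r _ 2) ?nnegrE ?enorm_ge0//.
have [+ _] := xa_argmin 0; rewrite /lasso mulmx0 sub0r enormN.
rewrite -(enormN (F xa *m xa - b)) opprB.
have -> : l1norm (0 : 'cV[R]_d) = 0.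
  by rewrite /l1norm big1// => i _; rewrite mxE normr0.
have : 0 <= alpha * l1norm xa.
  by rewrite mulr_ge0 ?(ltW alpha_gt0)// (le_trans (enorm_ge0 _) (enorm_le_l1norm _)).
by rewrite /beta; lra.
Qed.

Lemma enorm_g_le : enorm g <= c1 * beta.
Proof.
apply: (le_trans (enorm_trmx_bound _ (ltW c1_gt0) (F_bounded xa))).
by rewrite ler_wpM2l ?(ltW c1_gt0)// residual_le.
Qed.

Lemma gap_ge0 A : 0 <= gap A.
Proof. by apply: sumr_ge0 => i _; rewrite sqr_ge0. Qed.

Lemma gapU A B : gap (A :|: B) <= gap A + gap B.
Proof.
rewrite /gap !(big_mkcond (fun i => i \in _)) -big_split/=; apply: ler_sum => i _.
rewrite finset.in_setU; have := sqr_ge0 (t - `|g i 0|).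
by case: (i \in A); case: (i \in B) => /=; lra.
Qed.

Lemma supp_normg i : i \in supp xa -> `|g i 0| = t.
Proof.
have [_ gp gn] := fixed_point_subgradient i; rewrite inE.
have [x0|x0|_] := ltgtP (xa i 0) 0 => // _.
  by rewrite gn// normrN gtr0_norm.
by rewrite gp// gtr0_norm.
Qed.

Lemma gap_supp : gap (supp xa) = 0.
Proof. by apply: big1 => i /supp_normg ->; rewrite subrr expr0n. Qed.

Lemma supported_supp (y : 'cV[R]_d) (A : {set 'I_d}) :
  supp y \subset A -> supported A y.
Proof.
move=> /fintype.subsetP yA i iA; apply/eqP; apply: contraNT iA => yi.
by apply: yA; rewrite inE.
Qed.

(** On [A], the threshold [t] is split into the gap and [`|g|]; the norm of the
    second part is at most that of [g]. *)
Lemma card_gap_le (A : {set 'I_d}) :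
  gap A <= m ^+ 2 -> #|A|%:R * t ^+ 2 <= (m + c1 * beta) ^+ 2.
Proof.
move=> gapA.
pose u : 'cV[R]_d := \col_i (t - `|g i 0|).
pose v : 'cV[R]_d := \col_i `|g i 0|.
have vg : enorm v = enorm g.
  by rewrite /enorm; congr Num.sqrt; apply: eq_bigr => i _; rewrite mxE real_normK ?num_real.
have uA : enorm (restr A u) <= m.
  rewrite -(@ler_pXn2r _ 2) ?nnegrE ?enorm_ge0// sqr_enorm_restr.
  by rewrite (le_trans _ gapA)// /gap; apply: ler_sum => i _; rewrite mxE.
have vA := enorm_restr_le A v.
have := ler_enormD (restr A u) (restr A v).
rewrite -restrD => uv.
have -> : #|A|%:R * t ^+ 2 = enorm (restr A (u + v)) ^+ 2.
  rewrite sqr_enorm_restr mulr_natl -sumr_const; apply: eq_bigr => i _.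
  by rewrite !mxE subrK.
rewrite ler_pXn2r ?nnegrE ?enorm_ge0 ?addr_ge0 ?mulr_ge0 ?(ltW c1_gt0)//.
by have := enorm_g_le; rewrite -vg; lra.
Qed.

Let w j := forward_step F b (x j) - forward_step F b xa.

(** [shrink_energy], summed over indices that are active in the new iterate or
    in [xa]. *)
Lemma energy j (A : {set 'I_d}) : A \subset L j.+1 ->
  enorm (restr A (e j.+1)) ^+ 2 + gap A <= enorm (restr A (w j)) ^+ 2.
Proof.
move=> /fintype.subsetP AL; rewrite !sqr_enorm_restr -big_split/=.
apply: ler_sum => i /AL; rewrite finset.in_setU !inE orbC => iL.
have xE : x j.+1 i 0 = shrink t (xa i 0 + g i 0 + w j i 0).
  rewrite {1}/x /iterate iterS soft_thresholdE -/(iterate _ _ _ _) -/(x j).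
  by congr shrink; rewrite /w forward_fixed !mxE; ring.
have -> : e j.+1 i 0 = x j.+1 i 0 - xa i 0.
  by rewrite {1}/e; move: (x j.+1) => y; rewrite !mxE.
move: iL; rewrite xE => iL.
exact: shrink_energy (fixed_point_subgradient i) iL.
Qed.

Lemma restr_e j : restr (L j) (e j) = e j.
Proof.
apply/colP => i; rewrite mxE; case: ifPn => // iL; apply/esym.
by apply: (supportedB _ _ iL); apply: supported_supp;
  [exact: finset.subsetUl|exact: finset.subsetUr].
Qed.

Section NonzeroFixedPoint.
Hypothesis xa_neq0 : xa != 0.

Let m_gt0 : 0 < m. Proof. exact: enorm_gt0. Qed.

Let beta_gt0 : 0 < beta.
Proof.
by rewrite -(pmulr_rgt0 _ c2_gt0) (lt_le_trans m_gt0)// fixed_point_le.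
Qed.

(** A nonzero [b] is attained with an l1-cost of at most [c2 * enorm b]. *)
Lemma one_le_c1c2 : 1 <= c1 * c2.
Proof.
have [z zc Fz] := F_onto 0.
rewrite -(ler_pM2r beta_gt0) mul1r {1}/beta -Fz -mulrA.
apply: (le_trans (enorm_mulmx_bound z (F_bounded 0))).
by rewrite ler_pM2l// (le_trans (enorm_le_l1norm _)).
Qed.

Lemma supp_neq0 : exists i, i \in supp xa.
Proof.
apply/existsP; apply: contraR xa_neq0 => /existsPn H; apply/eqP/colP => i.
by move: (H i); rewrite inE negbK mxE => /eqP.
Qed.

Lemma t_le : t <= c1 * beta.
Proof.
have [i /supp_normg <-] := supp_neq0.
exact: le_trans (entry_le_enorm _ _) enorm_g_le.
Qed.

(** The sparsity level is at least [((m + 2 * c1 * enorm b) / t) ^+ 2], and the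
    excess over the bound of [card_gap_le] is at least one because
    [t <= c1 * enorm b]. *)
Lemma gap_room (A : {set 'I_d}) : gap A <= m ^+ 2 -> #|A|%:R + 1 <= s0.
Proof.
move=> /card_gap_le HA.
have s0t : s0 * t ^+ 2 = ((c1 + c2 + c1 ^+ 2 * c2) * beta) ^+ 2.
  by rewrite /s0 /t; field; rewrite gt_eqF.
rewrite -(ler_pM2r (exprn_gt0 2 t_gt0)) s0t.
pose a := c1 * beta.
have a0 : 0 <= a by rewrite mulr_ge0 ?(ltW c1_gt0).
have tt : t ^+ 2 <= a ^+ 2.
  by rewrite ler_pXn2r ?nnegrE ?(ltW t_gt0)// t_le.
have : (m + 2 * a) ^+ 2 <= ((c1 + c2 + c1 ^+ 2 * c2) * beta) ^+ 2.
  have sum_ge : m + 2 * a <= (c1 + c2 + c1 ^+ 2 * c2) * beta.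
    have H1 := fixed_point_le.
    have H2 : a <= c1 * c2 * a by rewrite ler_peMl// one_le_c1c2.
    by move: H2; rewrite /a; lra.
  have ma0 : 0 <= m + 2 * a by apply: addr_ge0 => //; apply: mulr_ge0.
  by rewrite ler_pXn2r ?nnegrE// (le_trans ma0).
have : 0 <= m * a by rewrite mulr_ge0.
by move: HA (sqr_ge0 a); rewrite -/a; lra.
Qed.

Lemma step_uniform_rip j (A : {set 'I_d}) : A \subset L j.+1 ->
  #|L j :|: A|%:R <= s0 -> enorm (restr A (w j)) <= rho * enorm (e j).
Proof.
move=> AL sz.
have : enorm (restr (L j :|: A) (w j)) <= rho * enorm (e j).
  have -> : rho = gamma + 2 * c1 * c3 * (c2 * beta) + c3 * enorm b.
    by rewrite /rho /beta; ring.
  apply: (@forward_contraction _ _ _ _ _ _ _ s0) => //; try exact: ltW.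
  - apply: supported_supp; apply: fintype.subset_trans (finset.subsetUl _ _).
    exact: finset.subsetUl.
  - apply: supported_supp; apply: fintype.subset_trans (finset.subsetUl _ _).
    exact: finset.subsetUr.
  - exact: fixed_point_le.
by apply: le_trans; exact/enorm_restr_mono/finset.subsetUr.
Qed.

Let rho_ge0 : 0 <= rho.
Proof. by rewrite addr_ge0 ?mulr_ge0 ?addr_ge0 ?mulr_ge0 ?ltW. Qed.

Lemma energy_uniform_rip j (A : {set 'I_d}) : A \subset L j.+1 ->
  #|L j :|: A|%:R <= s0 ->
  enorm (restr A (e j.+1)) ^+ 2 + gap A <= rho ^+ 2 * enorm (e j) ^+ 2.
Proof.
move=> AL sz; apply: (le_trans (energy AL)).
by rewrite -exprMn ler_pXn2r ?nnegrE ?mulr_ge0 ?enorm_ge0// step_uniform_rip.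
Qed.

Lemma rho_sqr_le y : 0 <= y -> rho ^+ 2 * y <= y.
Proof. by move=> y0; rewrite ler_piMl// expr_le1// ltW. Qed.

(** The support of the next iterate is added index by index: as long as the
    set is small enough for restricted isometry, the energy estimate shows that
    there is room for one more index. *)
Lemma supports_small j (A : {set 'I_d}) :
  enorm (e j) ^+ 2 + gap (L j) <= m ^+ 2 -> A \subset L j.+1 ->
  #|L j :|: A|%:R <= s0.
Proof.
move=> inv; have [k] := ubnP #|A|; elim: k A => // k IH A; rewrite ltnS => Ak AL.
have [->|[i iA]] := set_0Vmem A.
  rewrite finset.setU0; have /gap_room : gap (L j) <= m ^+ 2.
    by have := sqr_ge0 (enorm (e j)); lra.
  by lra.
pose A' := A :\ i.
have A'L : A' \subset L j.+1 by exact: fintype.subset_trans (subD1set _ _) AL.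
have A'k : (#|A'| < k)%N by rewrite (leq_trans _ Ak)// (cardsD1 i A) iA.
have sz := IH A' A'k A'L.
have en := energy_uniform_rip A'L sz.
have /gap_room : gap (L j :|: A') <= m ^+ 2.
  have := gapU (L j) A'; have := sqr_ge0 (enorm (restr A' (e j.+1))).
  have := rho_sqr_le (sqr_ge0 (enorm (e j))).
  by lra.
apply: le_trans; rewrite -[1]/(1%:R) -natrD ler_nat.
rewrite -(finset.setD1K iA) -/A' finset.setUCA cardsU1.
by rewrite addnC leq_add2l; case: (_ \notin _).
Qed.

Lemma energy_decay j : enorm (e j) ^+ 2 + gap (L j) <= m ^+ 2 ->
  enorm (e j.+1) ^+ 2 + gap (L j.+1) <= rho ^+ 2 * enorm (e j) ^+ 2.
Proof.
move=> inv; rewrite -{1}(restr_e j.+1).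
by apply: energy_uniform_rip => //; apply: supports_small.
Qed.

Lemma e0E : e 0 = - xa.
Proof. by rewrite /e /x /iterate /= sub0r. Qed.

Lemma gap_L0 : gap (L 0) = 0.
Proof.
rewrite -[RHS]gap_supp; congr gap; apply/setP => i; rewrite finset.in_setU !inE.
by rewrite mxE eqxx.
Qed.

Lemma energy_bound j : enorm (e j) ^+ 2 + gap (L j) <= m ^+ 2.
Proof.
elim: j => [|j IH]; first by rewrite e0E enormN gap_L0 addr0.
apply: (le_trans (energy_decay IH)).
apply: (le_trans (rho_sqr_le (sqr_ge0 _))).
by have := gap_ge0 (L j); lra.
Qed.


(** Here the roles in [forward_contraction] are exchanged: the norm that enters
    is that of the iterate, which lies within [m] of [xa].  Its bound [2 * m]
    doubles the factor of [c1 * c2] with respect to [rho]. *)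
Lemma step_fixed_rip (s delta : R) j : 0 < delta -> rip s delta (F xa) ->
  #|L j :|: L j.+1|%:R <= s ->
  enorm (e j.+1) <= (delta + (1 + 4 * c1 * c2) * c3 * beta) * enorm (e j).
Proof.
move=> delta0 ripF sz.
have ej_le : enorm (e j) <= m.
  rewrite -(@ler_pXn2r _ 2) ?nnegrE ?enorm_ge0//.
  by have := energy_bound j; have := gap_ge0 (L j); lra.
have xj_le : enorm (x j) <= 2 * (c2 * beta).
  have -> : x j = e j + xa by rewrite subrK.
  apply: (le_trans (ler_enormD _ _)); rewrite -/m.
  by have := fixed_point_le; lra.
have suppx i : supp (x i) \subset L i by exact: finset.subsetUl.
have suppxa i : supp xa \subset L i by exact: finset.subsetUr.
have LW : L j \subset L j :|: L j.+1 by exact: finset.subsetUl.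
have wW : enorm (restr (L j :|: L j.+1) (w j)) <=
    (delta + (1 + 4 * c1 * c2) * c3 * beta) * enorm (e j).
  have -> : delta + (1 + 4 * c1 * c2) * c3 * beta =
      delta + 2 * c1 * c3 * (2 * (c2 * beta)) + c3 * enorm b.
    by rewrite /beta; ring.
  have -> : enorm (restr (L j :|: L j.+1) (w j)) =
      enorm (restr (L j :|: L j.+1) (forward_step F b xa - forward_step F b (x j))).
    by rewrite -enormN -restrN opprB.
  have -> : enorm (e j) = enorm (xa - x j) by rewrite -enormN opprB.
  apply: (@forward_contraction _ _ _ _ _ _ _ s) => //; try exact: ltW.
    exact/supported_supp/(fintype.subset_trans (suppxa j)).
  exact/supported_supp/(fintype.subset_trans (suppx j)).
apply: le_trans wW; apply: (@le_trans _ _ (enorm (restr (L j.+1) (w j)))).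
  rewrite -(@ler_pXn2r _ 2) ?nnegrE ?enorm_ge0// -{1}(restr_e j.+1).
  by apply: (le_trans _ (energy (fintype.subxx _))); rewrite lerDl gap_ge0.
exact/enorm_restr_mono/finset.subsetUr.
Qed.

(** A set that is too large for the isometry assumption at the fixed point has
    many indices with a gap close to [t], because few entries of [g] are close
    to [t]; the tail supremum of [xa + g] counts the latter. *)
Lemma gap_large (c k : R) (A : {set 'I_d}) :
  64 <= c -> sparse k xa ->
  4 * m ^+ 2 / alpha ^+ 2 + 4 * c / alpha * tail_sup (forward_step F b xa) + k
    < #|A|%:R ->
  (63 / 64 * m) ^+ 2 <= gap A.
Proof.
move=> c64 xak; rewrite forward_fixed; set C := tail_sup _ => Abig.
have C0 : 0 <= C by exact: tail_sup_ge0.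
have Ct0 : 0 <= C / t by rewrite divr_ge0// ltW.
pose P := [set i | t / 64 <= `|g i 0|]%SET.
have P_le : #|P|%:R <= k + 2 * c * (C / t).
  have cCt : 64 * (C / t) <= c * (C / t) by rewrite ler_wpM2r.
  have k1 : 1 <= k.
    apply: le_trans xak; rewrite (ler_nat R 1); apply/card_gt0P.
    by have [i] := supp_neq0; rewrite inE => xi; exists i; rewrite inE.
  have [P1|P1] := leqP #|P| 1.
    by have : #|P|%:R <= 1 :> R; [rewrite (ler_nat R _ 1)|lra].
  have tau0 : 0 <= t / 64 by rewrite divr_ge0// ltW.
  have := card_large_le_tail_sup tau0 _ P1 (z := xa + g); rewrite -/C => H.
  have {}H : #|P|%:R * (t / 64) <= 2 * C.
    apply: H => i; rewrite inE => gi; apply: (le_trans gi).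
    have -> : (xa + g) i 0 = xa i 0 + g i 0 by rewrite [LHS]mxE.
    have [_ gp gn] := fixed_point_subgradient i.
    have [x0|x0|x0] := ltgtP (xa i 0) 0; last by rewrite x0 add0r.
      by rewrite gn// normrN (gtr0_norm t_gt0) ltr0_norm; move: t_gt0; lra.
    by rewrite gp// !gtr0_norm ?addr_gt0//; lra.
  suff : #|P|%:R <= 128 * (C / t) by lra.
  by rewrite mulrA ler_pdivlMr//; lra.
have sz : (m / t) ^+ 2 <= #|A :\: P|%:R.
  have Asplit : #|A|%:R <= #|A :\: P|%:R + #|P|%:R :> R.
    rewrite -natrD ler_nat -(cardsID P A) addnC leq_add2l.
    exact/subset_leq_card/finset.subsetIr.
  have KE : 4 * m ^+ 2 / alpha ^+ 2 + 4 * c / alpha * C =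
      (m / t) ^+ 2 + 2 * c * (C / t).
    by rewrite /t; field; rewrite gt_eqF.
  by move: Abig; rewrite KE; lra.
apply: (@le_trans _ _ (#|A :\: P|%:R * (63 / 64 * t) ^+ 2)).
  rewrite (exprMn _ (63 / 64) m) (exprMn _ (63 / 64) t) [leRHS]mulrCA.
  rewrite ler_wpM2l ?sqr_ge0//.
  by rewrite -ler_pdivrMr ?exprn_gt0// -expr_div_n.
rewrite mulr_natl -sumr_const /gap [leLHS]big_mkcond [leRHS]big_mkcond.
apply: ler_sum => i _; rewrite !inE -ltNge.
case: (i \in A); rewrite ?andbF//= andbT.
case: ltP => gi; last exact: sqr_ge0.
by rewrite ler_pXn2r ?nnegrE//; move: t_gt0; lra.
Qed.

(** Two consecutive energy estimates telescope.  For [j = 0] there is only one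
    step, and [L 0] has no gap. *)
Lemma two_step_energy j :
  enorm (e j.+1) ^+ 2 + gap (L j :|: L j.+1) <=
    rho ^+ 2 * enorm (e j.-1) ^+ 2.
Proof.
have H1 := energy_decay (energy_bound j).
have H2 := gapU (L j) (L j.+1).
case: j => [|j] /= in H1 H2 *; first by rewrite gap_L0 in H2; lra.
have H3 := energy_decay (energy_bound j).
have := rho_sqr_le (sqr_ge0 (enorm (e j.+1))).
by lra.
Qed.

End NonzeroFixedPoint.
End Iteration.

(** * Convergence with the rate of the restricted isometry constant *)

(** If [(63 / 64 * m) ^+ 2] can be lost, then [rho] and [q] are at least
    [63 / 64], so that [q * gamma ^+ 2] is at least [63 / 64 * (63 / 128) ^+ 2],
    which exceeds [1 / 5]; but less than [(m / 5) ^+ 2] is left for [E ^+ 2]. *)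
Lemma energy_loss (R : realType) (rho gamma q m E : R) :
  0 <= rho <= 1 -> rho <= 2 * gamma -> 0 <= q <= 1 -> 0 < m -> 0 <= E ->
  E ^+ 2 + (63 / 64 * m) ^+ 2 <= rho ^+ 2 * (q * m) ^+ 2 ->
  E <= q * gamma ^+ 2 * m.
Proof.
move=> /andP[rho0 rho1] rho2 /andP[q0 q1] m0 E0 H.
have E2 := sqr_ge0 E.
have rq : 63 / 64 <= rho * q.
  rewrite -(ler_pM2r m0) -(@ler_pXn2r _ 2) ?nnegrE ?mulr_ge0 ?(ltW m0)//.
  by move: H; rewrite !exprMn; lra.
have rq_r : rho * q <= rho by rewrite ler_piMr.
have rq_q : rho * q <= q by rewrite ler_piMl.
have g2 : (63 / 128) ^+ 2 <= gamma ^+ 2 by rewrite ler_pXn2r ?nnegrE//; lra.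
have H5 : 63 / 64 * (63 / 128) ^+ 2 <= q * gamma ^+ 2.
  by apply: ler_pM => //; lra.
have rq1 : (rho * q) ^+ 2 <= 1 by rewrite expr_le1 ?mulr_ge0//; lra.
have m2 : 0 < m ^+ 2 by rewrite exprn_gt0.
have H6 : (rho * q) ^+ 2 * m ^+ 2 <= m ^+ 2 by rewrite ler_piMl// ltW.
have EE : E ^+ 2 <= (1 / 5 * m) ^+ 2.
  by move: H; rewrite !exprMn in H6 *; lra.
have : E <= 1 / 5 * m.
  by move: EE; rewrite ler_pXn2r ?nnegrE ?mulr_ge0 ?divr_ge0// ltW.
move=> /le_trans; apply; rewrite ler_wpM2r ?(ltW m0)//.
by apply: le_trans H5; lra.
Qed.

Lemma cvg_enorm (R : realType) d (x : nat -> 'cV[R]_d) (l : 'cV[R]_d) (q m : R) :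
  0 <= q < 1 -> (forall j, enorm (x j - l) <= q ^+ j * m) ->
  x j @[j --> \oo] --> l.
Proof.
move=> /andP[q0 q1] H; apply/cvg_ballP => eps eps0.
have : (fun j => q ^+ j * m) @ \oo --> (0 : R).
  by rewrite -[X in _ --> X](mul0r m); apply: cvgMl; apply: cvg_expr; rewrite ger0_norm.
move=> /cvgrPdist_lt /(_ eps eps0); apply: filterS => j.
rewrite sub0r normrN => small; split=> // i i'; rewrite ord1.
rewrite /ball/= distrC; apply: (le_lt_trans _ small).
have -> : x j i 0 - l i 0 = (x j - l) i 0 by rewrite !mxE.
by apply: (le_trans (entry_le_enorm _ _)); apply: (le_trans (H j)); exact: ler_norm.
Qed.

Theorem theorem4p7 (R : realType) :
  exists2 c0 : R, 0 < c0 &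
  forall c : R, c0 <= c ->
  forall (d n : nat) (F : 'cV[R]_d -> 'M[R]_(n, d)) (b : 'cV[R]_n)
    (alpha : R) (c1 c2 c3 gamma : R),
  0 < alpha -> 0 < c1 -> 0 < c2 -> 0 < c3 -> 0 < gamma ->
  (forall x : 'cV[R]_d, spectral_norm (F x) <= c1) ->
  (forall x : 'cV[R]_d,
    exists2 z : 'cV[R]_d, l1norm z <= c2 * enorm b & F x *m z = b) ->
  (forall x y : 'cV[R]_d,
    spectral_norm (F x - F y) <= c3 * enorm (x - y)) ->
  (forall x : 'cV[R]_d,
    rip (4 / alpha ^+ 2 * (c1 + c2 + c1 ^+ 2 * c2) ^+ 2 * enorm b ^+ 2)
      gamma (F x)) ->
  gamma < 1 - (1 + 2 * c1 * c2) * c3 * enorm b ->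
  forall Sa : 'cV[R]_d -> 'cV[R]_d,
  (forall x : 'cV[R]_d, is_argmin (lasso (F x) b alpha) (Sa x)) ->
  forall xa : 'cV[R]_d, xa = Sa xa ->
  forall k : R, sparse k xa ->
  let zhat := forward_step F b xa in
  let C := tail_sup zhat in
  let K := 4 * enorm xa ^+ 2 / alpha ^+ 2 + 4 * c / alpha * C in
  forall gammat : R, 0 < gammat -> gammat < gamma ->
  rip (K + k) gammat (F xa) ->
  gammat + (1 + 4 * c1 * c2) * c3 * enorm b < gamma ->
  (iterate F b alpha j @[j --> \oo] --> xa) /\
  (forall j : nat, enorm (iterate F b alpha j - xa) <= gamma ^+ j * enorm xa).
Proof.
(* [64] is the ratio of [t] to the size above which an entry of [g] is large. *)
exists 64 => // c c64 d n F b alpha c1 c2 c3 gamma alpha0 c1_0 c2_0 c3_0 gamma0.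
move=> Fbd Fonto Flip Frip gamma_lt Sa Sa_min xa xaS k xak zhat C K gammat.
move=> gammat0 gammat_lt Ftrip gammat_gap.
have xa_min : is_argmin (lasso (F xa) b alpha) xa by rewrite {2}xaS.
have rho_lt1 : gamma + (1 + 2 * c1 * c2) * c3 * enorm b < 1 by lra.
have c123 : 0 <= c1 * c2 * c3 * enorm b.
  by rewrite !mulr_ge0 ?enorm_ge0// ltW.
have c3b : 0 <= c3 * enorm b by rewrite mulr_ge0 ?enorm_ge0// ltW.
have gamma1 : gamma <= 1 by lra.
suff rate j : enorm (iterate F b alpha j - xa) <= gamma ^+ j * enorm xa.
  split=> //; apply: (@cvg_enorm _ _ _ _ gamma (enorm xa)) => //.
  by apply/andP; split; lra.
have [xa0|xa_neq0] := eqVneq xa 0.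
  by rewrite (iterate_fixed0 alpha0 xa_min j xa0) xa0 subrr enorm0 mulr0.
have m0 := enorm_gt0 xa_neq0.
have m_le := fixed_point_le alpha0 Fonto xa_min.
have bound := energy_bound alpha0 c1_0 c2_0 c3_0 gamma0 Fbd Fonto Flip Frip rho_lt1
  xa_min xa_neq0.
have two_step := two_step_energy alpha0 c1_0 c2_0 c3_0 gamma0 Fbd Fonto Flip Frip
  rho_lt1 xa_min xa_neq0.
have large := gap_large alpha0 xa_min xa_neq0 c64 xak.
rewrite -/zhat -/C -/K in large.
have step s delta j := @step_fixed_rip _ _ _ F b alpha c1 c2 c3 gamma xa alpha0 c1_0
  c2_0 c3_0 gamma0 Fbd Fonto Flip Frip rho_lt1 xa_min xa_neq0 s delta j.
elim/ltn_ind: j => -[_|j IH]; first by rewrite expr0 mul1r /iterate/= sub0r enormN.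
set x := fun j => iterate F b alpha j.
pose W := (supp (x j) :|: supp xa) :|: (supp (x j.+1) :|: supp xa).
have [W_small|W_big] := lerP #|W|%:R (K + k).
  apply: (le_trans (step _ _ _ gammat0 Ftrip W_small)).
  rewrite exprS -(mulrA gamma); apply: ler_pM.
  - by move: c123 c3b; lra.
  - exact: enorm_ge0.
  - exact: ltW.
  - exact: IH.
have gammaX (i : nat) : 0 <= gamma ^+ i <= 1.
  by rewrite exprn_ge0 ?exprn_ile1// ltW.
apply: (@le_trans _ _ (gamma ^+ j.-1 * gamma ^+ 2 * enorm xa)); last first.
  rewrite ler_wpM2r ?enorm_ge0// -exprD; case: (j) => [|i] /=; last by rewrite addn2.
  by rewrite expr2 expr1 ler_piMr// ltW.
apply: (@energy_loss _ (gamma + (1 + 2 * c1 * c2) * c3 * enorm b)) => //.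
- by apply/andP; split; lra.
- by lra.
- exact: enorm_ge0.
apply: (@le_trans _ _ ((gamma + (1 + 2 * c1 * c2) * c3 * enorm b) ^+ 2 *
    enorm (x j.-1 - xa) ^+ 2)).
  by apply: le_trans (two_step j); rewrite lerD2l; exact: large W_big.
rewrite ler_wpM2l ?sqr_ge0// ler_pXn2r ?nnegrE ?enorm_ge0 ?mulr_ge0 ?exprn_ge0 ?(ltW m0) ?(ltW gamma0)//.
by apply: IH; rewrite ltnS leq_pred.
Qed.
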